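(* Let $|\Sigma|=2$. Then the class $\varepsilon\mathcal{L}_{rev}$ of erasing reversal pattern languages over $\Sigma$ does not possess a family of positive characteristic sets.
   Context: Let $X=\{x_1,x_2,\ldots\}$ be a countably infinite set of variables disjoint from $\Sigma$. A pattern is a finite non-empty string $p$ over $\Sigma\cup X$ in which no element of $X$ occurs more than once; $\mathit{Var}(p)$ is its set of variables. A relational pattern is a pair $(p,R)$ with $p$ a pattern and $R$ a binary relation over $X$. A substitution is a mapping $\varphi:(\Sigma\cup X)^+\to\Sigma^*$ that is a morphism with respect to concatenation and is the identity on $\Sigma^+$. Here the relation on words is $rev=\{(w,v)\in\Sigma^*\times\Sigma^*\mid w=v^{rev}\}$, where $v^{rev}$ is the reversal of $v$. A substitution $\varphi$ is an $R$-substitution if $(x,y)\in R$ implies $\varphi(x)=\varphi(y)^{rev}$; variables may be replaced by the empty word. A relational pattern $(p,R)$ is reversal-friendly if the symmetric closure of $R$ contains no odd cycle (no closed walk of odd length, and in particular no loops). Equivalently, each connected class of related variables splits into two parts, such that related variables always lie in opposite parts. Define $\varepsilon L_{rev}(p,R)=\{\varphi(p)\mid\varphi\text{ is an }R\text{-substitution}\}$ and $\varepsilon\mathcal{L}_{rev}=\{\varepsilon L_{rev}(p,R)\mid(p,R)\text{ is a reversal-friendly relational pattern}\}$, a countable class, viewed as a family via an enumeration $(L_i)_{i\in\mathbb{N}}$. A set $S\subseteq\Sigma^*\times\{1\}$ is consistent with $L$ iff $(s,1)\in S$ implies $s\in L$. A family $(C_i)_{i\in\mathbb{N}}$ of finite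 subsets of $\Sigma^*\times\{1\}$ is a family of positive characteristic sets for $(L_i)_{i\in\mathbb{N}}$ iff (1) $C_i$ is consistent with $L_i$ for all $i$; (2) for all $i,j$, if $L_i\ne L_j$ and $C_i$ is consistent with $L_j$, then $C_j$ is not consistent with $L_i$. *)

(* Defs.v *)
From mathcomp Require Import all_boot.
From mathcomp Require Import boolp classical_sets functions cardinality.

Set Implicit Arguments.
Unset Strict Implicit.
Unset Printing Implicit Defensive.

Local Open Scope classical_set_scope.

(* The variables x_1, x_2, ... are represented by nat; the sum type makes
   them disjoint from the alphabet. *)
Definition symbol (Sigma : finType) : Type := (Sigma + nat)%type.

Definition pattern_vars (Sigma : finType) (p : seq (symbol Sigma)) : seq nat :=
  pmap (fun a => if a is inr x then Some x else None) p.

Definition is_pattern (Sigma : finType) (p : seq (symbol Sigma)) : Prop :=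
  p <> [::] /\ uniq (pattern_vars p).

(* Substitutions live on non-empty words, so nothing is required of the value
   of [phi] at the empty word. *)
Definition is_substitution (Sigma : finType)
    (phi : seq (symbol Sigma) -> seq Sigma) : Prop :=
  (forall u v, u <> [::] -> v <> [::] -> phi (u ++ v) = phi u ++ phi v) /\
  (forall w : seq Sigma, w <> [::] -> phi (map inl w) = w).

Definition word_rev (Sigma : finType) : set (seq Sigma * seq Sigma) :=
  [set wv | wv.1 = rev wv.2].

Definition is_R_substitution (Sigma : finType) (R : rel nat)
    (phi : seq (symbol Sigma) -> seq Sigma) : Prop :=
  is_substitution phi /\
  forall x y, R x y -> word_rev (phi [:: inr x], phi [:: inr y]).

(* [cycle e c] allows repeated vertices, so [c] ranges over all closed walks,
   with [size c] edges; a loop is the case [size c = 1]. *)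
Definition reversal_friendly (R : rel nat) : Prop :=
  forall c : seq nat, cycle [rel x y | R x y || R y x] c -> ~~ odd (size c).

Definition erasing_rev_language (Sigma : finType)
    (p : seq (symbol Sigma)) (R : rel nat) : set (seq Sigma) :=
  [set w | exists2 phi, is_R_substitution R phi & w = phi p].

Definition erasing_rev_languages (Sigma : finType) : set (set (seq Sigma)) :=
  [set L | exists (p : seq (symbol Sigma)) R,
    [/\ is_pattern p, reversal_friendly R & L = erasing_rev_language p R]].
Arguments erasing_rev_languages Sigma : clear implicits.

Definition positive_sample (Sigma : finType) (S : set (seq Sigma * nat)) : Prop :=
  finite_set S /\ S `<=` setT `*` [set 1].

Definition consistent (Sigma : finType)
    (S : set (seq Sigma * nat)) (L : set (seq Sigma)) : Prop :=
  forall s, S (s, 1) -> L s.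

Definition positive_characteristic_sets (Sigma : finType)
    (L : nat -> set (seq Sigma)) (C : nat -> set (seq Sigma * nat)) : Prop :=
  [/\ forall i, positive_sample (C i),
      forall i, consistent (C i) (L i)
    & forall i j, L i <> L j -> consistent (C i) (L j) ->
        ~ consistent (C j) (L i)].

(* Main.v *)
(* Condition (2) yields finite telltales: if C_i is included in L_j and L_j in
   L_i, then L_j = L_i.  The language {x x y y z z} has none.  A
   finite subset of it is contained in the language of some g1 g1 g2 g2 g3 g3
   in which no variable of g1 occurs exactly once in g1 g2 g3; since Sigma has two
   letters, a unique letter in the first root forces the other roots to commute,
   and then the first square can be taken empty.  Such a language is strictly
   smaller: take a word made of three squares of long products of distinct blocks
   a b^k a.  For each square some block lies inside the image of a single
   variable y, which occurs at most twice since the block does, so y is in g2 or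
   g3.  Two of the three squares then share the same g_i, and g_i g_i shows
   their blocks in an order which the word does not have. *)
Require Import Defs.
From mathcomp Require Import all_boot.
From mathcomp Require Import boolp classical_sets functions cardinality.
From mathcomp Require Import zify.

Local Open Scope classical_set_scope.

(** * Homomorphic images of words as reversal pattern languages *)

Definition hom {V : Type} {Sigma : finType} (sigma : V -> seq Sigma) (g : seq V) :
  seq Sigma := flatten (map sigma g).

Definition hom_language {V : Type} (Sigma : finType) (g : seq V) : set (seq Sigma) :=
  [set w | exists sigma : V -> seq Sigma, w = hom sigma g].

Lemma hom_cat {V : Type} {Sigma : finType} (sigma : V -> seq Sigma) g h :
  hom sigma (g ++ h) = hom sigma g ++ hom sigma h.
Proof. by rewrite /hom map_cat flatten_cat. Qed.

Lemma path_two_coloured (e : rel nat) (f : nat -> bool) :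
    (forall x y, e x y -> f y = ~~ f x) ->
  forall p x, path e x p -> f (last x p) = odd (size p) (+) f x.
Proof.
move=> ef; elim=> [|y p IH] x //= /andP[/ef fy /IH ->].
by rewrite fy; case: (f x); case: (odd _).
Qed.

(** Each edge flips the colour and a closed walk returns to its first colour, so the number of edges
    is even. *)
Lemma two_coloured_reversal_friendly (R : rel nat) (f : nat -> bool) :
  (forall x y, R x y -> f y = ~~ f x) -> reversal_friendly R.
Proof.
move=> fR [|x p] //= cyc.
have fsym x' y : [rel x y | R x y || R y x] x' y -> f y = ~~ f x'.
  by move=> /= /orP[/fR|/fR ->]; rewrite ?negbK.
have := path_two_coloured _ _ fsym _ _ cyc.
by rewrite last_rcons size_rcons /=; case: (f x); case: (odd _).
Qed.

Lemma substitution_flatten (Sigma : finType) (phi : seq (symbol Sigma) -> seq Sigma) p :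
  is_substitution phi -> p <> [::] -> phi p = flatten [seq phi [:: s] | s <- p].
Proof.
case=> phiM _; elim: p => [|s [|t p] IH] //= _; first by rewrite cats0.
by rewrite -[s :: _]cat1s phiM // IH.
Qed.

(* Repeated variables: the occurrences of a variable are all related to one
   hub variable outside the pattern, hence receive the same value, the reversal of the hub's. *)
Lemma nat_hom_language_erasing_rev (Sigma : finType) (g : seq nat) :
  g <> [::] -> erasing_rev_languages Sigma (hom_language Sigma g).
Proof.
move=> g0; set m := size g.
pose p : seq (symbol Sigma) := [seq inr i | i <- iota 0 m].
(* Variables below [m] stand for the positions of [g], and [m + c] is the hub of the variable
   [c]. *)
pose R : rel nat := fun x y => (x < m) && (y == m + nth 0 g x).
have p0 : p <> [::].
  by move=> /(congr1 size); rewrite size_map size_iota => /size0nil.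
exists p, R; split.
- split=> //; rewrite /pattern_vars /p.
  by rewrite map_pK ?iota_uniq.
- apply: (@two_coloured_reversal_friendly R (fun x => x < m)) => x y /andP[-> /eqP ->].
  by rewrite /=; lia.
- apply/seteqP; split=> w /=.
  + case=> sigma ->.
    pose val (s : symbol Sigma) := match s with
      | inl c => [:: c]
      | inr x => if x < m then sigma (nth 0 g x) else rev (sigma (x - m))
      end.
    exists (fun s => flatten (map val s)).
      split; first split.
      * by move=> u v _ _; rewrite map_cat flatten_cat.
      * by move=> u _; rewrite -map_comp /=; elim: u => //= c u ->.
      * move=> x y /andP[xm /eqP ->]; rewrite /word_rev /= !cats0 xm.
        by rewrite ltnNge leq_addr /= addKn revK.
    rewrite /hom /p -map_comp; congr flatten.
    rewrite -[in LHS](mkseq_nth 0 g) /mkseq -map_comp.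
    by apply/eq_in_map => i; rewrite mem_iota /= => ->.
  + case=> phi [phiS phiR] ->; exists (fun c => rev (phi [:: inr (m + c)])).
    rewrite (substitution_flatten _ _ _ phiS p0) /hom /p -map_comp.
    congr flatten; rewrite -[in RHS](mkseq_nth 0 g) /mkseq -map_comp.
    apply/eq_in_map => i; rewrite mem_iota /= => im.
    by apply: (phiR i (m + nth 0 g i)); rewrite /R im eqxx.
Qed.

(** Later variables are pairs; [pickle] renames them injectively to numbers, which leaves the
    language unchanged. *)
Lemma hom_language_erasing_rev (Sigma : finType) (V : countType) (g : seq V) :
  g <> [::] -> erasing_rev_languages Sigma (hom_language Sigma g).
Proof.
move=> g0; have -> : hom_language Sigma g = hom_language Sigma (map pickle g).
  apply/seteqP; split=> w /= [sigma ->].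
  - exists (fun n => oapp sigma [::] (unpickle n)).
    by rewrite /hom -map_comp; congr flatten; apply: eq_map => v /=; rewrite pickleK.
  - by exists (sigma \o pickle); rewrite /hom -map_comp.
by apply: nat_hom_language_erasing_rev; case: g g0.
Qed.

(** * Products of three squares and sublanguages covering a finite sample *)

Definition squares3 {T : Type} (x y z : seq T) := x ++ x ++ y ++ y ++ z ++ z.

Lemma count_squares3 {T : Type} (p : pred T) x y z :
  count p (squares3 x y z) = (count p x + count p y + count p z).*2.
Proof. rewrite /squares3 !count_cat; lia. Qed.

Lemma hom_squares3 {V : Type} {Sigma : finType} (sigma : V -> seq Sigma) x y z :
  hom sigma (squares3 x y z) = squares3 (hom sigma x) (hom sigma y) (hom sigma z).
Proof. by rewrite /squares3 !hom_cat. Qed.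

(* If a letter of [u1] occurs nowhere else in [u1 ++ u2 ++ u3], then [u2] and
   [u3] are powers of the other letter, so [u2 u2 u3 u3] is a single square. *)
Lemma squares3_no_unique_letter (Sigma : finType) (u1 u2 u3 : seq Sigma) :
  #|Sigma| = 2 ->
  exists v1 v2 v3, squares3 u1 u2 u3 = squares3 v1 v2 v3 /\
    forall c, c \in v1 -> 1 < count_mem c (v1 ++ v2 ++ v3).
Proof.
move=> card2; have [ok|] := boolP (all (fun c => 1 < count_mem c (u1 ++ u2 ++ u3)) u1).
  by exists u1, u2, u3; split=> //; apply/allP.
case/allPn=> c cu1; rewrite -leqNgt !count_cat => cnt.
have {}cu1 : 0 < count_mem c u1 by rewrite -has_count has_pred1.
have [b other] : {b | predC1 c =i pred1 b} by apply: mem_card1; rewrite cardC1 card2.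
have powb u : count_mem c u = 0 -> exists i, u = nseq i b.
  move=> cu; exists (size u); apply/all_pred1P/allP => d du.
  have := other d; rewrite !inE => <-.
  by apply: contraTneq du => ->; rewrite -has_pred1 has_count cu.
have [||[i ->] [j ->]] := (powb u2 _, powb u3 _); [lia | lia |].
(* With an empty first root the condition on its letters is vacuous. *)
exists [::], u1, (nseq (i + j) b); split=> //.
rewrite /squares3 /= -!nseqD.
by do 2 congr (_ ++ _); congr nseq; lia.
Qed.

(* The variables of the sublanguage are pairs (sample word, letter);
   the substitution [select w] spells out [w] and erases the other samples. *)
Definition indexed_letters {Sigma : finType} (T : seq (seq Sigma))
    (u : seq Sigma -> seq Sigma) : seq (seq Sigma * Sigma) :=
  flatten [seq [seq (w, c) | c <- u w] | w <- T].

Definition select {Sigma : finType} (w : seq Sigma) (x : seq Sigma * Sigma) :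
  seq Sigma := if x.1 == w then [:: x.2] else [::].

Lemma hom_select (Sigma : finType) (T : seq (seq Sigma)) u w :
  uniq T -> w \in T -> hom (select w) (indexed_letters T u) = u w.
Proof.
have one v w' : hom (select w') [seq (v, c) | c <- u v] = if v == w' then u v else [::].
  rewrite /hom -map_comp; case: eqP => [->|/eqP vw]; elim: (u _) => //= c s ->.
    by rewrite /select eqxx.
  by rewrite /select (negPf vw).
rewrite /indexed_letters; elim: T => //= v S IH /andP[vS Suniq].
rewrite inE hom_cat one; have [-> _|_ /= wS] := eqVneq w v; last exact: IH.
rewrite [X in _ ++ X](_ : _ = [::]) ?cats0 //.
elim: S vS {IH Suniq} => //= x S IH; rewrite inE negb_or hom_cat => /andP[vx /IH ->].
by rewrite one eq_sym (negPf vx).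
Qed.

Lemma count_indexed_letters (Sigma : finType) (T : seq (seq Sigma)) u w c :
  uniq T -> w \in T ->
  count_mem (w, c) (indexed_letters T u) = count_mem c (u w).
Proof.
move=> Tuniq wT; rewrite -[in RHS](@hom_select _ T u) // /hom.
elim: indexed_letters => //= -[v d] s ->; rewrite count_cat /select /= xpair_eqE.
by case: eqP => _ //=; rewrite addn0.
Qed.

Lemma mem_indexed_letters (Sigma : finType) (T : seq (seq Sigma)) u w c :
  (w, c) \in indexed_letters T u -> w \in T /\ c \in u w.
Proof. by case/flatten_mapP=> v vT /mapP[d du [-> ->]]. Qed.

(** Split each sample word into three squares without unique letter in the first root, and
    concatenate corresponding roots with letters tagged by their word. Tagging preserves
    multiplicities, and [select] recovers each sample. *)
Lemma finite_sample_in_sublanguage (Sigma : finType) (T : seq (seq Sigma)) :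
    #|Sigma| = 2 ->
    (forall w, w \in T -> exists u1 u2 u3, w = squares3 u1 u2 u3) ->
  exists g1 g2 g3 : seq (seq Sigma * Sigma),
    (forall w, w \in T -> hom_language Sigma (squares3 g1 g2 g3) w) /\
    (forall y, y \in g1 -> 1 < count_mem y (g1 ++ g2 ++ g3)).
Proof.
move=> card2 Tsq.
have /choice[v vP] (w : seq Sigma) : exists v : seq Sigma * seq Sigma * seq Sigma,
    w \in T -> w = squares3 v.1.1 v.1.2 v.2 /\
      forall c, c \in v.1.1 -> 1 < count_mem c (v.1.1 ++ v.1.2 ++ v.2).
  have [wT|//] := boolP (w \in T); last by exists ([::], [::], [::]).
  have [u1 [u2 [u3 ->]]] := Tsq _ wT.
  have [v1 [v2 [v3 [-> ok]]]] := squares3_no_unique_letter _ u1 u2 u3 card2.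
  by exists (v1, v2, v3).
(* A repeated sample would be spelled out several times by [select]. *)
pose g f := indexed_letters (undup T) f.
exists (g (fun w => (v w).1.1)), (g (fun w => (v w).1.2)), (g (fun w => (v w).2)).
split=> [w wT|[w c] /mem_indexed_letters[]].
  exists (select w); rewrite hom_squares3 /g !hom_select ?undup_uniq ?mem_undup //.
  by have [] := vP w wT.
rewrite mem_undup => wT cv; have [_ /(_ c cv)] := vP w wT.
by rewrite !count_cat /g !count_indexed_letters ?undup_uniq ?mem_undup.
Qed.

(** * Locating blocks in a word *)

Definition block {Sigma : finType} (a b : Sigma) (k : nat) : seq Sigma :=
  a :: nseq k b ++ [:: a].
Arguments block : simpl never.

(* The lengths of the gaps between consecutive occurrences of [a]. *)
Fixpoint gaps {Sigma : finType} (a : Sigma) (w : seq Sigma) : seq nat :=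
  if w is c :: w' then
    if c == a then 0 :: gaps a w' else (head 0 (gaps a w')).+1 :: behead (gaps a w')
  else [:: 0].

Lemma gaps_cat (Sigma : finType) (a : Sigma) u v :
  gaps a (u ++ a :: v) = gaps a u ++ gaps a v.
Proof.
elim: u => [|c u IH] /=; first by rewrite eqxx.
rewrite IH; case: eqP => // _.
have : gaps a u != [::] by case: u {IH} => //= d s; case: (d == a).
by case: (gaps a u).
Qed.

Lemma gaps_nseq (Sigma : finType) (a b : Sigma) k :
  a != b -> gaps a (nseq k b) = [:: k].
Proof. by move=> ab; elim: k => //= k ->; rewrite eq_sym (negPf ab). Qed.

Lemma gaps_block (Sigma : finType) (a b : Sigma) k u v : a != b ->
  gaps a (u ++ block a b k ++ v) = gaps a u ++ k :: gaps a v.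
Proof.
by move=> ab; rewrite /block /= -catA !gaps_cat gaps_nseq.
Qed.

(** The two ends and the junctions of adjacent blocks contribute only gaps of length 0, which the
    filter removes. *)
Lemma gaps_blocks (Sigma : finType) (a b : Sigma) ks : a != b -> all (leq 1) ks ->
  filter (leq 1) (gaps a (flatten (map (block a b) ks))) = ks.
Proof.
move=> ab; elim: ks => // k ks IH /andP[k0 ks0].
by rewrite map_cons -[flatten (_ :: _)]/([::] ++ block a b k ++ _) gaps_block //= k0 IH.
Qed.

Fixpoint has_blocks {Sigma : finType} (a b : Sigma) (ks : seq nat)
    (w : seq Sigma) : Prop :=
  if ks is k :: ks' then exists u v, w = u ++ block a b k ++ v /\ has_blocks a b ks' v
  else True.

(** Disjoint blocks account for different gaps, in the same order. *)
Lemma has_blocks_subseq (Sigma : finType) (a b : Sigma) ks w : a != b ->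
  has_blocks a b ks w -> subseq ks (gaps a w).
Proof.
move=> ab; elim: ks w => [|k ks IH] w; first by rewrite sub0seq.
case=> u [v [-> /IH sub]]; rewrite gaps_block //.
by rewrite -[k :: ks]cat0s; apply: cat_subseq; rewrite ?sub0seq //= eqxx.
Qed.

Lemma has_blocks_cat (Sigma : finType) (a b : Sigma) ks ks' u v :
  has_blocks a b ks u -> has_blocks a b ks' v -> has_blocks a b (ks ++ ks') (u ++ v).
Proof.
move=> + v_ks'; elim: ks u => [|k ks IH] u.
  case: ks' v_ks' => // k ks' [x [y [-> yks]]] _.
  by exists (u ++ x), y; rewrite catA.
by case=> x [y [-> /IH H]]; exists x, (y ++ v); rewrite -!catA.
Qed.

Lemma has_blocks_hom (Sigma : finType) (a b : Sigma) (V : eqType)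
    (sigma : V -> seq Sigma) k y g :
  has_blocks a b [:: k] (sigma y) ->
  has_blocks a b (nseq (count_mem y g) k) (hom sigma g).
Proof.
move=> yk; elim: g => //= z g IH; rewrite -[_ :: g]cat1s hom_cat nseqD.
apply: has_blocks_cat => //; rewrite /hom /= cats0.
by case: eqP => [->|].
Qed.

(* Each cut point between consecutive [xs] lies inside at most one of the [bs]. *)
Lemma uncut_factor (A : eqType) (xs bs : seq (seq A)) u v :
    all (fun w => w != [::]) bs -> size xs < size bs ->
    flatten xs = u ++ flatten bs ++ v ->
  exists b x, [/\ b \in bs, x \in xs & exists s t, x = s ++ b ++ t].
Proof.
elim: xs bs u => [|x xs IH] [|b bs] u //= /andP[b0 bs0] lt.
  by case: u b b0 => [|? ?] [|? ?].
move=> eqw.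
have next ds w : {subset ds <= b :: bs} -> all (fun w => w != [::]) ds ->
    size xs < size ds -> flatten xs = w ++ flatten ds ++ v ->
    exists b' x', [/\ b' \in b :: bs, x' \in x :: xs & exists s t, x' = s ++ b' ++ t].
  move=> sub ds0 lts /(IH _ _ ds0 lts)[b' [x' [b'ds x'xs st]]].
  by exists b', x'; split=> //; [apply: sub | rewrite inE x'xs orbT].
have [xu|ux] := leqP (size x) (size u).
  apply: (next (b :: bs) (drop (size x) u)) => //=; first by rewrite b0.
    exact: ltnW.
  have /(congr1 (drop (size x))) := eqw.
  rewrite drop_size_cat // drop_cat ltn_neqAle xu andbT.
  by case: eqP => [->|//]; rewrite subnn drop0 drop_size.
have [xub|ubx] := leqP (size (u ++ b)) (size x).
  exists b, x; rewrite !mem_head; split=> //; exists u, (drop (size (u ++ b)) x).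
  have /(congr1 (take (size x))) := eqw.
  rewrite take_size_cat // -catA catA take_cat ltnNge xub /= => ->.
  by rewrite drop_size_cat // catA.
(* The end of [x] cuts [b]: both are dropped, which keeps the strict inequality of sizes. *)
apply: (next bs (drop (size x) (u ++ b))) => //.
  by move=> z zs; rewrite inE zs orbT.
have /(congr1 (drop (size x))) := eqw.
by rewrite drop_size_cat // -catA catA drop_cat ubx.
Qed.

Lemma subseq2_cat (A : eqType) (x y : A) s t :
  x \notin t -> y \notin s -> ~~ subseq [:: y; x] (s ++ t).
Proof.
move=> xt; elim: s => [_|z s IH] /=.
  by apply: contra xt => /mem_subseq; apply; rewrite !inE eqxx orbT.
by rewrite inE negb_or => /andP[/negPf-> /IH].
Qed.

(** * Strictness of the sublanguage *)

Lemma squares3_witness (Sigma : finType) (V : eqType) (g1 g2 g3 : seq V) :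
    1 < #|Sigma| -> (forall y, y \in g1 -> 1 < count_mem y (g1 ++ g2 ++ g3)) ->
  exists u1 u2 u3, ~ hom_language Sigma (squares3 g1 g2 g3) (squares3 u1 u2 u3).
Proof.
case/card_gt1P=> a [b [_ _ ab]] multi.
set g := squares3 g1 g2 g3; set n := (size g).+1.
(* Consecutive disjoint intervals of [n] exponents, starting at 1 so that no exponent is confused
   with the gap 0 between blocks. *)
pose K i := iota (n * i).+1 n.
pose U i := flatten (map (block a b) (K i)).
exists (U 0), (U 1), (U 2) => -[sigma eqw].
pose ks := squares3 (K 0) (K 1) (K 2).
have Uks : hom sigma g = flatten (map (block a b) ks).
  by rewrite -eqw /ks /squares3 !map_cat !flatten_cat.
have ks_pos : all (leq 1) ks.
  apply/allP => k; rewrite !mem_cat !mem_iota; lia.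
have sub ls : all (leq 1) ls -> has_blocks a b ls (hom sigma g) -> subseq ls ks.
  move=> ls_pos /(has_blocks_subseq _ _ _ _ _ ab); rewrite Uks.
  by rewrite -{2}(gaps_blocks _ _ _ _ ab ks_pos) subseq_filter ls_pos.
have found i : i < 3 -> exists2 k, k \in K i &
    has_blocks a b [:: k] (hom sigma g2) \/ has_blocks a b [:: k] (hom sigma g3).
  move=> i3.
  have [p [q pq]] : exists p q, hom sigma g = p ++ U i ++ q.
    rewrite -eqw /squares3; case: i i3 => [|[|[|//]]] _.
    - by exists [::]; eexists.
    - by exists (U 0 ++ U 0); eexists; rewrite -!catA.
    - by exists (U 0 ++ U 0 ++ U 1 ++ U 1); eexists; rewrite -!catA.
  (* [U i] has [n] blocks and [g] only [n - 1] letters, so some block is uncut. *)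
  have [||_ [_ [/mapP[k kK ->] /mapP[y yg ->] st]]] := uncut_factor _ _ _ _ _ _ _ pq.
  - by apply/allP => _ /mapP[k _ ->].
  - by rewrite !size_map size_iota.
  exists k => //; have {st} yk : has_blocks a b [:: k] (sigma y).
    by case: st => s [t ->]; exists s, t.
  have k0 : 0 < k by move: kK; rewrite mem_iota; lia.
  (* Each occurrence of [y] yields its own block of exponent [k], and [k] occurs just twice in
     [ks]. *)
  have cnt : count_mem y g <= 2.
    have : subseq (nseq (count_mem y g) k) ks.
      by apply: sub; [rewrite all_nseq k0 orbT | apply: has_blocks_hom].
    move=> /(leq_count_subseq (pred1 k)); rewrite count_nseq /ks (count_squares3 _ (K 0)).
    have cntK j : count_mem k (K j) = (n * j < k <= n * j + n).
      by rewrite count_uniq_mem ?iota_uniq // mem_iota.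
    rewrite !cntK /= eqxx; lia.
  have hg h : y \in h -> has_blocks a b [:: k] (hom sigma h).
    rewrite -has_pred1 has_count => yh.
    have := has_blocks_hom _ _ _ _ _ _ _ h yk.
    by case: (count_mem y h) yh => //= m _ [s [t [-> _]]]; exists s, t.
  (* A variable of [g1] occurs at least twice among the roots, hence four times in [g]. *)
  have yg1 : y \notin g1.
    apply: contraTN cnt => /multi; rewrite /g count_squares3 !count_cat; lia.
  move: yg; rewrite /g /squares3 !mem_cat (negPf yg1) /=.
  by have [/hg|_] := boolP (y \in g2); [left | move=> /= /orP[]/hg; right].
(* The first copy of [h] provides [l] and the second one [k], but in [ks] all of [K i] precedes
   [K j]. *)
have clash i j k l h : i < j -> j < 3 -> k \in K i -> l \in K j ->
    (exists p q, g = p ++ h ++ h ++ q) ->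
    has_blocks a b [:: k] (hom sigma h) -> has_blocks a b [:: l] (hom sigma h) -> False.
  move=> ij j3 kK lK [p [q gE]] hk hl.
  have : subseq [:: l; k] ks.
    apply: sub; first by move: kK lK; rewrite !mem_iota /=; lia.
    rewrite gE !hom_cat; apply: (has_blocks_cat _ _ _ [::]) => //.
    apply: (has_blocks_cat _ _ _ [:: l]) => //.
    by apply: (has_blocks_cat _ _ _ [:: k] [::]).
  apply/negP; move: kK lK; rewrite !mem_iota => kK lK.
  (* Cut [ks] after its first square if [i] is 0, and before its third square otherwise. *)
  case: i ij kK => [|i] ij kK.
    rewrite /ks /squares3 catA; apply: subseq2_cat; rewrite !mem_cat !mem_iota; nia.
  rewrite /ks /squares3 !catA -(catA _ (K 2)).
  apply: subseq2_cat; rewrite !mem_cat !mem_iota; nia.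
have g2E : exists p q, g = p ++ g2 ++ g2 ++ q.
  by exists (g1 ++ g1), (g3 ++ g3); rewrite /g /squares3 -!catA.
have g3E : exists p q, g = p ++ g3 ++ g3 ++ q.
  by exists (g1 ++ g1 ++ g2 ++ g2), [::]; rewrite cats0 /g /squares3 -!catA.
have [k0 K0 H0] := found 0 isT; have [k1 K1 H1] := found 1 isT.
have [k2 K2 H2] := found 2 isT.
have c01 := clash 0 1 k0 k1 _ isT isT K0 K1.
have c02 := clash 0 2 k0 k2 _ isT isT K0 K2.
have c12 := clash 1 2 k1 k2 _ isT isT K1 K2.
(* Pigeonhole: two of the three squares have their block in the same root, [g2] or [g3]. *)
case: H0 H1 H2 => [H0|H0] [H1|H1] [H2|H2]; eauto.
Qed.

Theorem theorem1 (Sigma : finType) (card_Sigma : #|Sigma| = 2)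
    (L : nat -> set (seq Sigma))
    (enumL : range L = erasing_rev_languages Sigma) :
  ~ exists C : nat -> set (seq Sigma * nat), positive_characteristic_sets L C.
Proof.
case=> C [Csample Ccons Cchar].
have idx l : erasing_rev_languages Sigma l -> exists i, L i = l.
  by rewrite -enumL => -[i _ <-]; exists i.
have [i Li] : exists i, L i = hom_language Sigma (squares3 [:: 0] [:: 1] [:: 2]).
  by apply/idx/hom_language_erasing_rev.
have LiP w : L i w <-> exists u1 u2 u3, w = squares3 u1 u2 u3.
  rewrite Li; split=> [[sigma ->]|[u1 [u2 [u3 ->]]]].
    by rewrite hom_squares3; do 3 eexists.
  exists (nth [::] [:: u1; u2; u3]).
  by rewrite hom_squares3 /hom /= !cats0.
have [a _] : exists a : Sigma, true.
  by have /card_gt0P[a] : 0 < #|Sigma| by [rewrite card_Sigma]; exists a.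
have /finite_seqP[S CS] := (Csample i).1.
(* The additional nonempty word forces the word of variables to be nonempty, as a pattern must
   be. *)
pose T := [:: a; a] :: [seq s.1 | s <- S & s.2 == 1].
have TLi w : w \in T -> exists u1 u2 u3, w = squares3 u1 u2 u3.
  rewrite inE => /orP[/eqP ->|/mapP[[v m]]]; first by exists [:: a], [::], [::].
  rewrite mem_filter /= => /andP[/eqP -> vS] ->.
  by apply/LiP/Ccons; rewrite CS.
have [g1 [g2 [g3 [Tg multi]]]] := finite_sample_in_sublanguage _ T card_Sigma TLi.
have [j Lj] : exists j, L j = hom_language Sigma (squares3 g1 g2 g3).
  apply/idx/hom_language_erasing_rev => g0.
  by have [|sigma] := Tg [:: a; a]; [exact: mem_head | rewrite g0].
have sub w : L j w -> L i w.
  by rewrite Lj => -[sigma ->]; apply/LiP; rewrite hom_squares3; do 3 eexists.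
(* [C i] lies in [L j] by construction, and [C j] lies in [L i] because [L j] does. *)
apply: (Cchar i j).
- have [||u1 [u2 [u3 nw]]] := squares3_witness Sigma _ g1 g2 g3.
  + by rewrite card_Sigma.
  + exact: multi.
  by rewrite -Lj in nw => LiLj; apply: nw; rewrite -LiLj; apply/LiP; do 3 eexists.
- move=> w; rewrite CS /= => wS; rewrite Lj; apply: Tg.
  by rewrite inE; apply/orP; right; apply/mapP; exists (w, 1); rewrite ?mem_filter.
- by move=> w /(Ccons j)/sub.
Qed.
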